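(* Let $(x_t)_{t\ge 0}$ be the iterates of the Stochastic Frank-Wolfe (SFW) method (defined in the context) for the problem $\min_{x\in C}F(x)$, and let $x^*\in\arg\min_{x\in C}F(x)$. Suppose that: (1) $\|x-y\|\le D$ for all $x,y\in C$; (2) $F$ is convex and $\|\nabla F(x)-\nabla F(y)\|\le L\|x-y\|$ for all $x,y\in C$; (3) the stochastic gradients are unbiased, $\mathbb{E}_{z\sim P}[\nabla\tilde F(x,z)]=\nabla F(x)$, and $\mathbb{E}_{z\sim P}\big[\|\nabla\tilde F(x,z)-\nabla F(x)\|^2\big]\le\sigma^2$ for all $x\in C$. If $\rho_t$ and $\gamma_t$ are chosen such that (i) $\sum_{t=0}^\infty\rho_t=\infty$, (ii) $\sum_{t=0}^\infty\rho_t^2<\infty$, (iii) $\sum_{t=0}^\infty\gamma_t=\infty$, and (iv) $\sum_{t=0}^\infty(\gamma_t^2/\rho_t)<\infty$, then $$\lim_{t\to\infty}\big(F(x_t)-F(x^* )\big)=0\quad\text{almost surely}.$$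
   Context: Setting: $C\subset\mathbb{R}^n$ is a nonempty compact convex set, $z$ is a random variable with distribution $P$, $\tilde F(x,z)$ is a stochastic function, and $F(x)=\mathbb{E}_{z\sim P}[\tilde F(x,z)]$. Only $F$ (not $\tilde F(\cdot,z)$) is assumed convex and smooth. $\|\cdot\|$ is the Euclidean norm. SFW method: given deterministic stepsizes $\rho_t>0$ and $\gamma_t\in(0,1]$, a deterministic starting point $x_0\in C$ and $d_0=0\in\mathbb{R}^n$, and i.i.d. samples $z_1,z_2,\dots\sim P$, the iterates are defined by $$d_t=(1-\rho_t)d_{t-1}+\rho_t\nabla\tilde F(x_t,z_t)\quad(t\ge1),$$ $$v_t\in\arg\min_{v\in C}d_t^Tv,\qquad x_{t+1}=(1-\gamma_{t+1})x_t+\gamma_{t+1}v_t\quad(t\ge0).$$ (Since $d_0=0$, $v_0$ is an arbitrary fixed point of $C$; minimizers $v_t$ are chosen measurably.) *)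

(* Defs.v *)
From HB Require Import structures.
From mathcomp Require Import all_boot all_order all_algebra finmap.
From mathcomp Require Import all_classical all_reals all_analysis.
Import Order.TTheory GRing.Theory Num.Theory.
Import numFieldNormedType.Exports.

Set Implicit Arguments.
Unset Strict Implicit.
Unset Printing Implicit Defensive.

Local Open Scope classical_set_scope.
Local Open Scope ring_scope.

Definition dotv (R : realType) (n : nat) (u v : 'rV[R]_n) : R :=
  (u *m v^T) 0 0.

(* The canonical norm `|v| on 'rV[R]_n is the max norm, hence this definition;
   both induce the same topology and the same notion of differentiability. *)
Definition norm2 (R : realType) (n : nat) (v : 'rV[R]_n) : R :=
  Num.sqrt (dotv v v).

(* Meaningful at points where f is differentiable. *)
Definition grad (R : realType) (n : nat) (f : 'rV[R]_n -> R) (x : 'rV[R]_n) :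
    'rV[R]_n :=
  \row_(i < n) 'D_(delta_mx 0 i) f x.

Definition argmin (R : realType) (T : Type) (C : set T) (f : T -> R) : set T :=
  [set x | C x /\ forall y, C y -> f x <= f y].

(* R^n with its Borel sigma-algebra (the library puts none on 'rV[R]_n). *)
Definition borel_rV (R : realType) (n : nat) :=
  g_sigma_algebraType (@open 'rV[R]_n).

(* F(x) = E_{z ~ P}[Ftilde(x, z)] *)
Definition expected_fun (R : realType) (n : nat) (dZ : measure_display)
    (Z : measurableType dZ) (P : probability Z R)
    (Ftilde : 'rV[R]_n -> Z -> R) (x : 'rV[R]_n) : R :=
  fine ('E_P[Ftilde x])%E.

Definition mutually_independent (R : realType) (dW dZ : measure_display)
    (W : measurableType dW) (Z : measurableType dZ) (Q : probability W R)
    (I : choiceType) (X : I -> {RV Q >-> Z}) : Prop :=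
  forall (J : {fset I}) (A : I -> set Z), (forall i, measurable (A i)) ->
    (Q (\bigcap_(i in [set` J]) (X i @^-1` A i)) =
     \prod_(i <- J) Q (X i @^-1` A i))%E.

Definition iid_samples (R : realType) (dW dZ : measure_display)
    (W : measurableType dW) (Z : measurableType dZ) (Q : probability W R)
    (P : probability Z R) (X : nat -> {RV Q >-> Z}) : Prop :=
  mutually_independent X /\
  forall (k : nat) (A : set Z), measurable A -> distribution Q (X k) A = P A.

(* The sample z_t of the method (t >= 1) is z t; z 0 is never used.
   "Chosen measurably" means that v_t is a Borel function of the samples seen so
   far, i.e. is measurable for the sigma-algebra generated by z_1, ..., z_t: it
   may not depend on future samples. For t = 0 this sigma-algebra is trivial and
   v_0 is a fixed point of C, arbitrary since d_0 = 0. *)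
Record is_SFW (R : realType) (n : nat) (dW dZ : measure_display)
    (W : measurableType dW) (Z : measurableType dZ) (Q : probability W R)
    (C : set 'rV[R]_n) (Ftilde : 'rV[R]_n -> Z -> R) (rho gamma : nat -> R)
    (x0 : 'rV[R]_n) (z : nat -> {RV Q >-> Z})
    (x d v : nat -> W -> 'rV[R]_n) : Prop := IsSFW {
  SFW_x0 : forall w, x 0%N w = x0 ;
  SFW_d0 : forall w, d 0%N w = 0 ;
  SFW_d : forall t w, d t.+1 w =
    (1 - rho t.+1) *: d t w
      + rho t.+1 *: grad (Ftilde ^~ (z t.+1 w)) (x t.+1 w) ;
  SFW_v : forall t w, argmin C (dotv (d t w)) (v t w) ;
  SFW_v_adapted : forall t (B : set (borel_rV R n)), measurable B ->
    g_sigma_preimage (fun k : 'I_t => (z k.+1 : W -> Z)) (v t @^-1` B) ;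
  SFW_x : forall t w, x t.+1 w =
    (1 - gamma t.+1) *: x t w + gamma t.+1 *: v t w
}.

(* Main.v *)
Require Import Defs.
From HB Require Import structures.
From mathcomp Require Import all_boot all_order all_algebra finmap.
From mathcomp Require Import all_classical all_reals all_analysis.
From mathcomp Require Import measurable_realfun.
From mathcomp Require Import zify ring lra.
Import Order.TTheory GRing.Theory Num.Theory.
Import numFieldNormedType.Exports.

Set Implicit Arguments.
Unset Strict Implicit.
Unset Printing Implicit Defensive.

Local Open Scope classical_set_scope.
Local Open Scope ring_scope.

(** The gap [F (x t w) - F xstar] is controlled by the error
    [err t w = norm2 (d t w - grad F (x t w)) ^+ 2] of the averaged direction
    as an estimate of the true gradient.

    Pathwise, [frank_wolfe_step] gives
    [gap t.+1 <= (1 - g) * gap t + g * (D * sqrt (err t) + `|L| * D ^+ 2 * g)]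
    with [g = gamma t.+1]. It compares [F] at consecutive iterates through the
    convexity inequality taken at the new iterate, so that only values of the
    gradient in [C] enter, and no integration along the segment is needed.
    Since the stepsizes [gamma] tend to [0] but have an infinite sum,
    [relaxation_cvg0] sends the gap to [0] as soon as [err t w] tends to [0].

    What remains is that [err] tends to [0] almost surely. Given the samples
    [z 1], ..., [z t], the iterate [x t.+1] is known and the error at time
    [t.+1] is a known vector plus centered noise, so the cross terms integrate
    to [0] ([second_moment_shift_le], [err_step]). The Lipschitz bound on the
    gradient and the convexity of the square then give
    [E[err t.+1 | past] <= (1 - rho t.+1) * err t + b t.+1] with
    [b t = (`|L| * D * gamma t) ^+ 2 / rho t + rho t ^+ 2 * sigma ^+ 2] once
    [rho t.+1 <= 1], and these [b t] have a finite sum ([err_contraction]).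
    Hence [err t + tail b t], with [tail b t] the sum of the later [b]'s, is
    eventually a nonnegative supermartingale, and its expectation tends to [0]
    because the sum of the [rho t] is infinite. The maximal inequality for
    nonnegative supermartingales bounds the probability that it ever exceeds a
    level [l] after time [t] by [l^-1] times its expectation at [t], which
    yields almost sure convergence directly, without any martingale convergence
    theorem ([almost_supermartingale_cvg0]).

    Conditioning on the past is expressed by integrating over events of the
    sigma-algebra [past z t] generated by the first [t] samples. Independence
    makes the joint law of the past and of the next sample a product measure
    ([past_independent]), and Tonelli's theorem integrates the next sample out
    ([integral_next_sample]). This requires the stochastic gradient to be
    jointly measurable in the point and the sample, which follows from the
    measurability of [Ftilde] on an open set around [C] by difference quotients
    ([measurable_grad_coord]). *)

(** * Deterministic recursions *)

Lemma sum_unbounded (R : realType) (g : nat -> R) (T : nat) (M : R) :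
  (forall t, 0 <= g t) -> (\sum_(0 <= t <oo) (g t)%:E = +oo)%E ->
  exists n, M < \sum_(T <= t < T + n) g t.
Proof.
move=> g0 goo; apply: contrapT => /forallNP H.
have : (\sum_(0 <= t <oo) (g t)%:E <= (\sum_(0 <= t < T) g t + M)%:E)%E.
  apply: lime_le; first by apply: is_cvg_nneseries => n _ _; rewrite lee_fin.
  near=> n; rewrite sumEFin lee_fin.
  have Tn : (T <= n)%N by near: n; exists T.
  rewrite (@big_cat_nat _ _ _ T) //= lerD2l.
  by have /negP := H (n - T)%N; rewrite subnKC // -leNgt.
by rewrite goo leye_eq.
Unshelve. all: by end_near. Qed.

(** Were [p] bounded below by some [e > 0], each step would remove at least
    [e * g t.+1] from it, and these amounts sum to infinity. *)
Lemma contraction_cvg0 (R : realType) (g p : nat -> R) (T : nat) :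
  (forall t, 0 <= g t) -> (\sum_(0 <= t <oo) (g t)%:E = +oo)%E ->
  (forall t, 0 <= p t) ->
  (forall t, (T <= t)%N -> p t.+1 <= (1 - g t.+1) * p t) ->
  p @ \oo --> (0 : R).
Proof.
move=> g0 goo p0 pS.
have p_noninc t : (T <= t)%N -> p t.+1 <= p t.
  move=> Tt; apply: le_trans (pS _ Tt) _.
  by rewrite ler_piMl// lerBlDr lerDl.
have p_le s t : (T <= s)%N -> (s <= t)%N -> p t <= p s.
  move=> Ts /subnKC <-; elim: (t - s)%N => [|k IH]; first by rewrite addn0.
  by rewrite addnS; apply: le_trans IH; apply: p_noninc; lia.
apply/cvgrPdist_lt => e e0.
have [[s Ts pse]|] := pselect (exists2 s, (T <= s)%N & p s < e).
  exists s => // t /= st; rewrite sub0r normrN ger0_norm//.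
  exact: le_lt_trans (p_le _ _ Ts st) pse.
move=> /forall2NP H; exfalso.
have pe s : (T <= s)%N -> e <= p s.
  by move=> Ts; have [//|/negP] := H s; rewrite -leNgt.
have [n] := @sum_unbounded R g T.+1 (p T / e) g0 goo.
apply/negP; rewrite -leNgt ler_pdivlMr//.
suff : p (T + n)%N <= p T - (\sum_(T.+1 <= t < T.+1 + n) g t) * e.
  by have := p0 (T + n)%N; lra.
elim: n => [|n IH]; first by rewrite !addn0 big_geq// mul0r subr0.
rewrite !addnS big_nat_recr/= ?leq_addr// addSn.
apply: le_trans (pS _ _) _; first by rewrite leq_addr.
have := pe (T + n)%N (leq_addr _ _); have := g0 (T + n).+1.
by move: IH; rewrite addSn; nra.
Qed.

(** Above any level [e > 0] that eventually dominates the forcing term, the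
    excess [Num.max 0 (u t - e)] contracts. *)
Lemma relaxation_cvg0 (R : realType) (g u eps : nat -> R) (T : nat) :
  (forall t, 0 <= g t) -> (\sum_(0 <= t <oo) (g t)%:E = +oo)%E ->
  (forall t, (T <= t)%N -> g t <= 1) ->
  (forall t, 0 <= u t) -> eps @ \oo --> (0 : R) ->
  (forall t, (T <= t)%N -> u t.+1 <= (1 - g t.+1) * u t + g t.+1 * eps t) ->
  u @ \oo --> (0 : R).
Proof.
move=> g0 goo g1 u0 eps0 uS; apply/cvgrPdist_lt => e e0.
have e20 : 0 < e / 2 by rewrite divr_gt0.
have [T' _ epsT'] : \forall t \near \oo, eps t < e / 2.
  move/cvgrPdist_lt/(_ _ e20): eps0; apply: filterS => t.
  by rewrite sub0r normrN; apply: le_lt_trans; rewrite ler_norm.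
have m0 t : 0 <= Num.max 0 (u t - e / 2) by rewrite le_max lexx.
have : (fun t => Num.max 0 (u t - e / 2)) @ \oo --> (0 : R).
  apply: (@contraction_cvg0 _ g _ (maxn T T')) => //.
  move=> t; rewrite geq_max => /andP[Tt T't].
  have := epsT' t T't; have := uS t Tt; have := g1 t.+1 (leqW Tt).
  have := g0 t.+1; have : u t - e / 2 <= Num.max 0 (u t - e / 2).
    by rewrite le_max lexx orbT.
  have := m0 t; set m := Num.max 0 (u t - e / 2) => mt0 um gt0 gt1 ut et.
  rewrite ge_max; apply/andP; split; first by rewrite mulr_ge0// subr_ge0.
  have : (1 - g t.+1) * (u t - e / 2) <= (1 - g t.+1) * m.
    by rewrite ler_wpM2l// subr_ge0.
  have : g t.+1 * eps t <= g t.+1 * (e / 2) by rewrite ler_wpM2l// ltW.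
  lra.
move=> /cvgrPdist_lt/(_ _ e20); apply: filterS => t.
rewrite !sub0r !normrN !ger0_norm ?le_max ?lexx//.
by rewrite gt_max => /andP[_]; lra.
Qed.

(** For a convergent series, the sum of the [b i] with [t < i]. *)
Definition tail (R : realType) (b : nat -> R) (t : nat) : R :=
  limn (series b) - series b t.+1.

Lemma tailS (R : realType) (b : nat -> R) t : tail b t.+1 = tail b t - b t.+1.
Proof. by rewrite /tail /series/= [in LHS]big_nat_recr//= opprD addrA. Qed.

Lemma tail_ge0 (R : realType) (b : nat -> R) t :
  (forall t, 0 <= b t) -> (\sum_(0 <= t <oo) (b t)%:E < +oo)%E ->
  0 <= tail b t.
Proof.
move=> b0 boo; rewrite /tail subr_ge0.
apply: (@nondecreasing_cvgn_le _ (series b)); last first.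
  exact: (nnseries_is_cvg b0 boo).
by apply/nondecreasing_seqP => n; rewrite /series/= big_nat_recr//= lerDl.
Qed.

Lemma tail_cvg0 (R : realType) (b : nat -> R) :
  (forall t, 0 <= b t) -> (\sum_(0 <= t <oo) (b t)%:E < +oo)%E ->
  tail b @ \oo --> (0 : R).
Proof.
move=> b0 boo; rewrite -(subrr (limn (series b))); apply: cvgB.
  exact: cvg_cst.
have cb : series b @ \oo --> limn (series b) by exact: nnseries_is_cvg.
by move: cb; rewrite -cvg_shiftS.
Qed.

(** Adding the remaining perturbation [tail b] turns the recursion into a
    relaxation towards [tail b], which vanishes. *)
Lemma perturbed_contraction_cvg0 (R : realType) (r b a : nat -> R) (T : nat) :
  (forall t, 0 <= r t) -> (\sum_(0 <= t <oo) (r t)%:E = +oo)%E ->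
  (forall t, (T <= t)%N -> r t <= 1) ->
  (forall t, 0 <= b t) -> (\sum_(0 <= t <oo) (b t)%:E < +oo)%E ->
  (forall t, 0 <= a t) ->
  (forall t, (T <= t)%N -> a t.+1 <= (1 - r t.+1) * a t + b t.+1) ->
  a @ \oo --> (0 : R).
Proof.
move=> r0 roo r1 b0 boo a0 aS.
have s0 t := tail_ge0 t b0 boo.
have : (fun t => a t + tail b t) @ \oo --> (0 : R).
  apply: (@relaxation_cvg0 _ r _ (tail b) T) => //.
  - by move=> t; exact: addr_ge0.
  - exact: tail_cvg0.
  by move=> t Tt; have := aS t Tt; rewrite tailS; lra.
move=> H; have : (fun t => (a t + tail b t) - tail b t) @ \oo --> (0 - 0 : R).
  by apply: cvgB => //; exact: tail_cvg0.
by rewrite subr0; under eq_fun do rewrite addrK.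
Qed.

Lemma summable_cvg0 (R : realType) (b : nat -> R) :
  (forall t, 0 <= b t) -> (\sum_(0 <= t <oo) (b t)%:E < +oo)%E ->
  b @ \oo --> (0 : R).
Proof. by move=> b0 boo; apply: cvg_series_cvg_0; exact: nnseries_is_cvg. Qed.

Lemma sqr_cvg0 (R : realType) (u : nat -> R) :
  (fun t => u t ^+ 2) @ \oo --> (0 : R) -> u @ \oo --> (0 : R).
Proof.
move=> u2; apply/cvgrPdist_lt => e e0.
move/cvgrPdist_lt/(_ _ (exprn_gt0 2 e0)): u2; apply: filterS => t.
rewrite !sub0r !normrN normrX => ute.
by rewrite -(@ltr_pXn2r _ 2)// nnegrE// ltW.
Qed.

(** * A maximal inequality for nonnegative supermartingales *)

Definition hits (R : realType) (W : Type) (Y : nat -> W -> R) (l : R)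
    (n m : nat) : set W :=
  [set w | exists2 t, (n <= t <= n + m)%N & l <= Y t w].

Lemma hits0 (R : realType) (W : Type) (Y : nat -> W -> R) (l : R) n :
  hits Y l n 0 = [set w | l <= Y n w].
Proof.
apply/seteqP; split => w /=; last by exists n; rewrite // addn0 leqnn.
by move=> [t]; rewrite addn0 -eqn_leq => /eqP <-.
Qed.

Lemma hitsS (R : realType) (W : Type) (Y : nat -> W -> R) (l : R) n m :
  hits Y l n m.+1 = [set w | l <= Y n w] `|` hits Y l n.+1 m.
Proof.
apply/seteqP; split => w /=.
  move=> [t]; rewrite leq_eqVlt => /andP[/orP[/eqP <-|nt] tm lY]; first by left.
  by right; exists t => //; rewrite nt addSn -addnS.
move=> [lY|[t /andP[nt tm] lY]]; first by exists n; rewrite // leqnn leq_addr.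
by exists t => //; rewrite (ltnW nt) addnS -addSn.
Qed.

Lemma measurable_fun_superlevel (R : realType) d (W : measurableType d)
    (f : W -> R) :
  (forall l, measurable [set w | l <= f w]) -> measurable_fun setT f.
Proof.
move=> mf; apply: (measurability (@RGenCInfty.G R)).
  exact: RGenCInfty.measurableE.
move=> _ [_ [l ->] <-]; rewrite setTI.
rewrite (_ : _ @^-1` _ = [set w | l <= f w])//.
by apply/seteqP; split => w /=; rewrite in_itv/= andbT.
Qed.

Section supermartingale.
Context (R : realType) (dW : measure_display) (W : measurableType dW).
Variables (Q : probability W R) (G : nat -> set (set W)) (Y : nat -> W -> R).
Variable T : nat.
Hypothesis sG : forall t, sigma_algebra setT (G t).
Hypothesis Gm : forall t, G t `<=` measurable.
Hypothesis GS : forall t, G t `<=` G t.+1.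
Hypothesis Y0 : forall t w, 0 <= Y t w.
Hypothesis YG : forall t l, G t [set w | l <= Y t w].
Hypothesis Ysuper : forall t A, (T <= t)%N -> G t A ->
  (\int[Q]_(w in A) (Y t.+1 w)%:E <= \int[Q]_(w in A) (Y t w)%:E)%E.

Let GI t A B : G t A -> G t B -> G t (A `&` B).
Proof.
rewrite -(measurable_g_measurableTypeE (sG t)); exact: measurableI.
Qed.

Let GC t A : G t A -> G t (~` A).
Proof.
rewrite -(measurable_g_measurableTypeE (sG t)); exact: measurableC.
Qed.

Let mY t : measurable_fun setT (Y t).
Proof.
by apply: measurable_fun_superlevel => l; exact: (Gm (YG t l)).
Qed.

Lemma measurable_hits l n m : measurable (hits Y l n m).
Proof.
elim: m n => [|m IH] n; first by rewrite hits0; exact: (Gm (YG n l)).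
by rewrite hitsS; apply: measurableU; [exact: (Gm (YG n l))|exact: IH].
Qed.

(** Stop at the first time the level is reached: on the event that it is
    reached at once the bound is Markov's inequality, and on the complementary
    event, which belongs to the past, one step of the supermartingale reduces
    the horizon. *)
Lemma maximal_inequality_in (l : R) (n m : nat) (A : set W) :
  (T <= n)%N -> 0 <= l -> G n A ->
  (l%:E * Q (A `&` hits Y l n m) <= \int[Q]_(w in A) (Y n w)%:E)%E.
Proof.
move=> + l0; pose H k := [set w | l <= Y k w].
have mYE k B : measurable_fun B (fun w => (Y k w)%:E).
  by apply/measurable_EFinP; exact: measurable_funTS.
have markov_in k B : G k B ->
    (l%:E * Q (B `&` H k) <= \int[Q]_(w in B `&` H k) (Y k w)%:E)%E.
  move=> GB; have mBH := measurableI _ _ (Gm GB) (Gm (YG k l)).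
  rewrite -integral_cst//; apply: ge0_le_integral => //.
  by move=> w [_ lY]; rewrite lee_fin.
elim: m => [|m IH] in n A * => Tn GA.
  rewrite hits0; apply: le_trans (markov_in _ _ GA) _.
  apply: ge0_subset_integral => //.
  - exact: measurableI _ _ (Gm GA) (Gm (YG n l)).
  - exact: Gm GA.
  - by move=> w _; rewrite lee_fin.
pose B := A `&` ~` H n.
have GB : G n B by apply: GI => //; apply: GC; exact: YG.
have mAH := measurableI _ _ (Gm GA) (Gm (YG n l)).
have mh := measurable_hits.
have -> : A `&` hits Y l n m.+1 = (A `&` H n) `|` (B `&` hits Y l n.+1 m).
  rewrite hitsS; apply/seteqP; split => w /=.
    move=> [Aw Hw]; have [|Hn] := pselect (H n w); [left|right] => //.
    by rewrite /B/=; tauto.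
  by rewrite /B/=; tauto.
rewrite measureU//; last 2 first.
- exact: measurableI _ _ (Gm GB) (mh l n.+1 m).
- by rewrite /B; apply/seteqP; split => // w /= [[_ ?] [[_ ?] _]].
rewrite ge0_muleDr//.
have AE : A = (A `&` H n) `|` B by rewrite -setIUr setUv setIT.
rewrite [in leRHS]AE ge0_integral_setU//; last 3 first.
- exact: Gm GB.
- by move=> w _; rewrite lee_fin.
- by apply/disj_setPS => w [[_ ?] [_ ?]].
apply: leeD; first exact: markov_in.
apply: le_trans (Ysuper Tn GB).
by apply: IH; [exact: leqW|exact: GS].
Qed.

Hypothesis Yint0 : (fun n => (\int[Q]_w (Y n w)%:E)%E) @ \oo --> 0%E.

Lemma maximal_inequality (l : R) (n : nat) : (T <= n)%N -> 0 < l ->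
  (Q (\bigcup_m hits Y l n m) <= (l^-1)%:E * \int[Q]_w (Y n w)%:E)%E.
Proof.
move=> Tn l0; rewrite lee_pdivlMl//.
have : (l%:E * Q (hits Y l n m) @[m --> \oo] -->
    l%:E * Q (\bigcup_m hits Y l n m))%E.
  apply: cvgeZl => //; apply: nondecreasing_cvg_mu => //.
  - by move=> m; exact: measurable_hits.
  - by apply: bigcupT_measurable => m; exact: measurable_hits.
  - move=> m1 m2 m12; apply/subsetPset => w [t /andP[nt tm] lY].
    by exists t => //; rewrite nt (leq_trans tm)// leq_add2l.
move=> /cvge_to_le; apply; apply: nearW => m.
rewrite -[hits _ _ _ _]setTI; apply: maximal_inequality_in => //.
  exact: ltW.
by rewrite -setC0; apply: GC; have [] := sG n.
Qed.

(** The bound at level [l] from time [n] on tends to [0] with the expectation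
    of [Y n], so almost surely each level [1 / k.+1] is eventually avoided. *)
Lemma supermartingale_cvg0 : {ae Q, forall w, Y ^~ w @ \oo --> (0 : R)}.
Proof.
pose N l := \bigcap_n \bigcup_m hits Y l (n + T) m.
have N0 l : 0 < l -> Q.-negligible (N l).
  move=> l0; have mN : measurable (N l).
    apply: bigcapT_measurable => n; apply: bigcupT_measurable => m.
    exact: measurable_hits.
  exists (N l); split => //; apply/eqP; rewrite -measure_le0.
  have : ((l^-1)%:E * \int[Q]_w (Y (n + T)%N w)%:E @[n --> \oo] -->
      (l^-1)%:E * 0)%E.
    apply: cvgeZl => //.
    by move: Yint0; rewrite -(cvg_shiftn T).
  rewrite mule0 => /cvge_to_ge; apply; apply: nearW => n.
  apply: le_trans (maximal_inequality _ l0); last exact: leq_addl.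
  apply: le_measure; rewrite ?inE//.
    by apply: bigcupT_measurable => m; exact: measurable_hits.
  by move=> w; apply.
apply: (@negligibleS _ _ _ _ (\bigcup_k N (k.+1%:R^-1))); last first.
  by apply: negligible_bigcup => k; apply: N0; rewrite invr_gt0.
move=> w /=; apply: contra_notP => Nw; apply/cvgrPdist_lt => e e0.
have [k ke] : exists k : nat, k.+1%:R^-1 < e.
  exists (Num.trunc e^-1); rewrite invf_plt ?posrE//.
  by rewrite Num.Theory.truncnS_gt.
have : ~ N k.+1%:R^-1 w by move=> Nkw; apply: Nw; exists k.
move=> /existsNP[n /not_implyP[_ nH]]; exists (n + T)%N => // t /= nt.
rewrite sub0r normrN ger0_norm//; apply: le_lt_trans ke.
rewrite leNgt; apply/negP => Yt; apply: nH; exists (t - (n + T))%N => //.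
by exists t; [rewrite nt subnKC/=|exact: ltW].
Qed.

End supermartingale.

Section almost_supermartingale.
Context (R : realType) (dW : measure_display) (W : measurableType dW).
Variables (Q : probability W R) (G : nat -> set (set W)) (a : nat -> W -> R).
Variables (r b : nat -> R) (T : nat).
Hypothesis sG : forall t, sigma_algebra setT (G t).
Hypothesis Gm : forall t, G t `<=` measurable.
Hypothesis GS : forall t, G t `<=` G t.+1.
Hypothesis a0 : forall t w, 0 <= a t w.
Hypothesis aG : forall t l, G t [set w | l <= a t w].
Hypothesis a_int : forall t, (\int[Q]_w (a t w)%:E < +oo)%E.
Hypothesis r0 : forall t, 0 <= r t.
Hypothesis sum_r : (\sum_(0 <= t <oo) (r t)%:E = +oo)%E.
Hypothesis r1 : forall t, (T <= t)%N -> r t <= 1.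
Hypothesis b0 : forall t, 0 <= b t.
Hypothesis sum_b : (\sum_(0 <= t <oo) (b t)%:E < +oo)%E.
Hypothesis a_step : forall t A, (T <= t)%N -> G t A ->
  (\int[Q]_(w in A) (a t.+1 w)%:E <=
   \int[Q]_(w in A) ((1 - r t.+1) * a t w + b t.+1)%:E)%E.

Let ma t : measurable_fun setT (a t).
Proof. by apply: measurable_fun_superlevel => l; exact: (Gm (aG t l)). Qed.

Let maE t A : measurable_fun A (fun w => (a t w)%:E).
Proof. by apply/measurable_EFinP; exact: measurable_funTS. Qed.

Let alpha t := fine (\int[Q]_w (a t w)%:E).

Let alphaE t : (alpha t)%:E = (\int[Q]_w (a t w)%:E)%E.
Proof.
rewrite fineK// ge0_fin_numE//; apply: integral_ge0 => w _.
by rewrite lee_fin.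
Qed.

Let integral_shift A t k s : measurable A -> 0 <= k -> 0 <= s ->
  (\int[Q]_(w in A) (k * a t w + s)%:E =
   k%:E * \int[Q]_(w in A) (a t w)%:E + s%:E * Q A)%E.
Proof.
move=> mA k0 s0; under eq_integral do rewrite EFinD EFinM.
rewrite ge0_integralD//.
- rewrite integral_cst// ge0_integralZl//.
  by move=> w _; rewrite lee_fin.
- by move=> w _; rewrite mule_ge0// lee_fin.
- by apply: measurable_funeM; exact: maE.
Qed.

Lemma expectation_cvg0 : alpha @ \oo --> (0 : R).
Proof.
apply: (@perturbed_contraction_cvg0 _ r b _ T) => //.
- by move=> t; rewrite fine_ge0// integral_ge0// => w _; rewrite lee_fin.
move=> t Tt; have GT : G t setT.
  by rewrite -(measurable_g_measurableTypeE (sG t)); exact: measurableT.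
have := a_step Tt GT; rewrite integral_shift//; last first.
  by rewrite subr_ge0 r1// leqW.
rewrite [X in (_ + _ * X)%E](_ : _ = 1%E) ?mule1; last exact: probability_setT.
by rewrite -!alphaE -EFinM -EFinD lee_fin.
Qed.

(** From time [T] on, [a + tail b] is a nonnegative supermartingale, and its
    expectation tends to [0] like that of [a]. *)
Theorem almost_supermartingale_cvg0 :
  {ae Q, forall w, a ^~ w @ \oo --> (0 : R)}.
Proof.
have s0 t := tail_ge0 t b0 sum_b.
pose Y t w := a t w + tail b t.
have Y0 t w : 0 <= Y t w by exact: addr_ge0.
have YG t l : G t [set w | l <= Y t w].
  have := aG t (l - tail b t); congr (G t).
  by apply/seteqP; split => w /=; rewrite lerBlDr.
have Ysuper t A : (T <= t)%N -> G t A ->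
    (\int[Q]_(w in A) (Y t.+1 w)%:E <= \int[Q]_(w in A) (Y t w)%:E)%E.
  move=> Tt GA; have mA := Gm GA.
  have r01 : 0 <= 1 - r t.+1 by rewrite subr_ge0 r1// leqW.
  have YE k : (\int[Q]_(w in A) (Y k w)%:E =
      \int[Q]_(w in A) (a k w)%:E + (tail b k)%:E * Q A)%E.
    have := @integral_shift A k 1 (tail b k) mA ler01 (s0 k).
    rewrite mul1e => <-.
    by apply: eq_integral => w _; rewrite mul1r.
  rewrite !YE; apply: le_trans (leeD (a_step Tt GA) (lexx _)) _.
  rewrite integral_shift// -addeA -ge0_muleDl ?lee_fin//.
  rewrite -EFinD [b _ + _]addrC tailS subrK leeD2r//.
  rewrite gee_pMl//; first by apply: integral_ge0 => w _; rewrite lee_fin.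
  by rewrite lee_fin gerBl.
have Yint0 : (\int[Q]_w (Y n w)%:E)%E @[n --> \oo] --> 0%E.
  have YE n : (\int[Q]_w (Y n w)%:E)%E = (alpha n + tail b n)%:E.
    have := @integral_shift setT n 1 (tail b n) measurableT ler01 (s0 n).
    rewrite mul1e [X in (_ + _ * X)%E](_ : _ = 1%E) ?mule1; last first.
      exact: probability_setT.
    rewrite -alphaE -EFinD => <-.
    by apply: eq_integral => w _; rewrite mul1r.
  under eq_fun do rewrite YE.
  apply: cvg_EFin; first exact: nearW.
  rewrite -(addr0 0); apply: cvgD; first exact: expectation_cvg0.
  exact: tail_cvg0.
have := supermartingale_cvg0 sG Gm GS Y0 YG Ysuper Yint0.
apply: filterS => w Yw.
apply: (@squeeze_cvgr _ _ _ _ (cst 0) (Y ^~ w)) => //; last exact: cvg_cst.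
by apply: nearW => t; rewrite a0 lerDl s0.
Qed.

End almost_supermartingale.

(** * Independence of the past and integration over a fresh sample *)

Section past.
Context (R : realType) (dW dZ : measure_display) (W : measurableType dW)
  (Z : measurableType dZ) (Q : probability W R).
Variable z : nat -> {RV Q >-> Z}.

Definition past (t : nat) : set (set W) :=
  g_sigma_preimage (fun k : 'I_t => (z k.+1 : W -> Z)).

(** [W] carrying only the events known at time [t]. *)
Definition pastType (t : nat) := g_sigma_algebraType (past t).

Lemma past_sigma_algebra t : sigma_algebra setT (past t).
Proof. exact: smallest_sigma_algebra. Qed.

Lemma measurable_pastE t : @measurable _ (pastType t) = past t.
Proof. exact/measurable_g_measurableTypeE/past_sigma_algebra. Qed.

Lemma past_preimage t k (B : set Z) : (k < t)%N -> measurable B ->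
  past t (z k.+1 @^-1` B).
Proof.
move=> kt mB; apply: sub_sigma_algebra.
case: t kt => // t kt; rewrite -bigcup_mkord_ord; exists k => //.
by exists B => //; rewrite setTI inordK.
Qed.

Lemma past_sub t (S : set (set W)) : sigma_algebra setT S ->
  (forall k B, (k < t)%N -> measurable B -> S (z k.+1 @^-1` B)) ->
  past t `<=` S.
Proof.
move=> sS zS; apply: smallest_sub => //.
case: t zS => [|t] zS; first by rewrite big_ord0.
rewrite -bigcup_mkord_ord => A [k kt [B mB <-]]; rewrite setTI.
by have := zS k B kt mB; rewrite inordK.
Qed.

Lemma past_measurable t : past t `<=` measurable.
Proof.
apply: past_sub; first exact: sigma_algebra_measurable.
by move=> k B _ mB; rewrite -[_ @^-1` _]setTI; exact: measurable_funPT.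
Qed.

Lemma pastS t : past t `<=` past t.+1.
Proof.
apply: past_sub; first exact: past_sigma_algebra.
by move=> k B kt; apply: past_preimage; exact: leqW.
Qed.

Lemma measurable_past_funS d (T : measurableType d) t (f : W -> T) :
  measurable_fun setT (f : pastType t -> T) ->
  measurable_fun setT (f : pastType t.+1 -> T).
Proof.
move=> mf _ B mB; have := mf measurableT B mB.
by rewrite !measurable_pastE; exact: pastS.
Qed.

Lemma measurable_past_fun d (T : measurableType d) t (f : W -> T) :
  measurable_fun setT (f : pastType t -> T) -> measurable_fun setT f.
Proof.
move=> mf _ B mB; have := mf measurableT B mB.
by rewrite measurable_pastE; exact: past_measurable.
Qed.

Lemma measurable_forget t : measurable_fun setT (id : W -> pastType t).
Proof. exact: measurable_past_fun. Qed.

Lemma measurable_past_sample t k : (k < t)%N ->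
  measurable_fun setT (z k.+1 : pastType t -> Z).
Proof.
move=> kt _ B mB; rewrite setTI measurable_pastE; exact: past_preimage.
Qed.

Variable P : probability Z R.
Hypothesis z_iid : iid_samples P (fun k => z k.+1).

(* Built by successive insertions, so that a product over [J t.+1] splits off
   its factor of index [t]. *)
Let J (t : nat) : {fset nat} := iteri t (fun k A => k |` A)%fset fset0.

Let in_J t k : (k \in J t) = (k < t)%N.
Proof.
by elim: t => //= t IH; rewrite in_fset1U IH ltnS [in RHS]leq_eqVlt.
Qed.

Let cylinder (t : nat) (A : nat -> set Z) : set W :=
  \bigcap_(k in [set` J t]) z k.+1 @^-1` A k.

Let prob_cylinder t A B : (forall k, measurable (A k)) -> measurable B ->
  (Q (cylinder t A `&` z t.+1 @^-1` B) =
   Q (cylinder t A) * Q (z t.+1 @^-1` B))%E.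
Proof.
move=> mA mB; have [ind _] := z_iid.
pose A' k := if k == t then B else A k.
have mA' k : measurable (A' k) by rewrite /A'; case: ifP.
have A't : A' t = B by rewrite /A' eqxx.
have JA' k : k \in J t -> A' k = A k.
  by rewrite in_J /A' ltn_neqAle => /andP[/negPf ->].
have -> : cylinder t A `&` z t.+1 @^-1` B = cylinder t.+1 A'.
  apply/seteqP; split => w /=.
    move=> [zA zB] k; rewrite /= in_fset1U => /orP[/eqP ->|kJ].
      by rewrite A't.
    by rewrite JA'//; exact: zA.
  move=> zA; split.
    by move=> k kJ; rewrite -JA'//; apply: zA; rewrite /= in_fset1U kJ orbT.
  by have := zA t; rewrite /= A't; apply; rewrite in_fset1U eqxx.
rewrite /cylinder (ind (J t) _ mA) (ind (J t.+1) _ mA') /=.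
rewrite big_fsetU1/= ?in_J ?ltnn// A't muleC; congr (_ * _)%E.
by apply: eq_big_seq => k kJ; rewrite JA'.
Qed.

(** The intersections of finitely many events about single samples form a
    pi-system generating the past, on which the claim is the product rule. *)
Lemma past_independent t (E : set W) (B : set Z) : past t E -> measurable B ->
  (Q (E `&` z t.+1 @^-1` B) = Q E * P B)%E.
Proof.
move=> pE mB; have [_ zP] := z_iid; rewrite -(zP t B mB).
have mzB : measurable (z t.+1 @^-1` B).
  by rewrite -[_ @^-1` _]setTI; exact: measurable_funPT.
pose C : set (set W) :=
  [set E | exists2 A, (forall k, measurable (A k)) & E = cylinder t A].
have CT : C setT.
  by exists (fun=> setT) => //; apply/esym/seteqP; split.
pose q := fine (Q (z t.+1 @^-1` B)).
have q0 : (0 <= q)%R by rewrite fine_ge0.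
have qE : q%:E = Q (z t.+1 @^-1` B) by rewrite fineK// fin_num_measure.
transitivity (q%:E * Q E)%E; last by rewrite qE muleC.
have mC : C `<=` measurable.
  move=> _ [A mA ->]; apply: fin_bigcap_measurable => // k _.
  by rewrite -[_ @^-1` _]setTI; exact: measurable_funPT.
apply: (@g_sigma_algebra_measure_unique _ R W C mC (fun=> setT) (fun=> CT) _
  (mrestr Q mzB) (mscale (NngNum q0) Q)) => //=.
- by rewrite bigcup_const.
- move=> _ _ [A mA ->] [A' mA' ->]; exists (fun k => A k `&` A' k).
    by move=> k; exact: measurableI.
  by rewrite /cylinder -bigcapI.
- move=> _ [A mA ->]; rewrite /mscale/= /mrestr/= qE muleC.
  exact: prob_cylinder.
- by move=> _; rewrite /mrestr ltey_eq fin_num_measure//; exact: measurableI.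
- apply: past_sub pE; first exact: smallest_sigma_algebra.
  move=> k B' kt mB'; apply: sub_sigma_algebra.
  exists (fun i => if i == k then B' else setT).
    by move=> i; case: ifP.
  apply/seteqP; split => w /=.
    by move=> zB i; rewrite /= in_J => it; case: eqP => [->|].
  by move=> /(_ k); rewrite /= in_J eqxx; exact.
Qed.

(** The law of this random variable is [Q] restricted to the past. *)
Definition forget t : W -> pastType t := id.

HB.instance Definition _ t :=
  isMeasurableFun.Build _ _ _ _ (forget t) (@measurable_forget t).

Definition past_and_next t (w : W) : pastType t * Z := (w, z t.+1 w).

Lemma measurable_past_and_next t : measurable_fun setT (past_and_next t).
Proof.
by apply: measurable_fun_pair => //; exact: measurable_forget.
Qed.

HB.instance Definition _ t :=
  isMeasurableFun.Build _ _ _ _ (past_and_next t) (@measurable_past_and_next t).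

(** By independence the joint law of the past and the next sample is a product
    measure, so the next sample can be integrated out with the past frozen. *)
Lemma integral_next_sample t (H : pastType t * Z -> \bar R) (A : set W) :
  past t A -> measurable_fun setT H -> (forall p, 0 <= H p)%E ->
  (\int[Q]_(w in A) H (w, z t.+1 w) = \int[Q]_(w in A) \int[P]_y H (w, y))%E.
Proof.
move=> pA mH H0.
have mA : measurable (A : set (pastType t)) by rewrite measurable_pastE.
pose H' : pastType t * Z -> \bar R := H \_ (A `*` setT).
have mH' : measurable_fun setT H'.
  have mAT : measurable (A `*` setT : set (pastType t * Z)).
    exact: measurableX.
  have [mr _] := measurable_restrictT H mAT.
  exact: (mr (measurable_funTS mH)).
have H'0 p : (0 <= H' p)%E by rewrite /H' erestrict_ge0.
transitivity (\int[Q]_w H' (past_and_next t w))%E.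
  rewrite integral_mkcond; apply: eq_integral => w _.
  by rewrite /H' /patch/= in_setX in_setT andbT.
have prodE X : measurable X ->
    (distribution Q (forget t) \x P)%E X = distribution Q (past_and_next t) X.
  move=> mX; apply: product_measure_unique => // E B mE mB.
  rewrite /distribution/= /pushforward/=.
  have pE : past t E by rewrite -measurable_pastE.
  exact: past_independent pE mB.
transitivity (\int[distribution Q (forget t) \x P]_p H' p)%E.
  rewrite (eq_measure_integral (distribution Q (past_and_next t))) => [|X mX _].
    by rewrite ge0_integral_pushforward// => p _; exact: H'0.
  exact: prodE.
rewrite fubini_tonelli1// ge0_integral_pushforward//; last 2 first.
- exact: measurable_fun_fubini_tonelli_F.
- by move=> p _; apply: integral_ge0.
rewrite [RHS]integral_mkcond; apply: eq_integral => w _ /=.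
rewrite /fubini_F /patch/=; case: ifPn => wA; last first.
  apply: integral0_eq => y _.
  by rewrite /H' /patch in_setX/= (negPf wA).
by apply: eq_integral => y _; rewrite /H' /patch in_setX/= in_setT andbT wA.
Qed.

End past.

(** * Euclidean geometry *)

Section euclidean.
Context (R : realType) (n : nat).
Implicit Types u v w : 'rV[R]_n.

Lemma addv_coord u v i : (u + v) 0 i = u 0 i + v 0 i.
Proof. by rewrite mxE. Qed.

Lemma subv_coord u v i : (u - v) 0 i = u 0 i - v 0 i.
Proof. by rewrite !mxE. Qed.

Lemma scalev_coord a u i : (a *: u) 0 i = a * u 0 i.
Proof. by rewrite mxE. Qed.

Lemma dotvE u v : dotv u v = \sum_i u 0 i * v 0 i.
Proof. by rewrite /dotv mxE; apply: eq_bigr => i _; rewrite mxE. Qed.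

Lemma dotvC u v : dotv u v = dotv v u.
Proof. by rewrite !dotvE; apply: eq_bigr => i _; rewrite mulrC. Qed.

Lemma dotvDl u v w : dotv (u + v) w = dotv u w + dotv v w.
Proof. by rewrite /dotv mulmxDl mxE. Qed.

Lemma dotvZl a u w : dotv (a *: u) w = a * dotv u w.
Proof. by rewrite /dotv -scalemxAl mxE. Qed.

Lemma dotvBl u v w : dotv (u - v) w = dotv u w - dotv v w.
Proof. by rewrite dotvDl -scaleN1r dotvZl mulN1r. Qed.

Lemma dotvDr u v w : dotv w (u + v) = dotv w u + dotv w v.
Proof. by rewrite dotvC dotvDl !(dotvC w). Qed.

Lemma dotvZr a u w : dotv w (a *: u) = a * dotv w u.
Proof. by rewrite dotvC dotvZl (dotvC w). Qed.

Lemma dotvBr u v w : dotv w (u - v) = dotv w u - dotv w v.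
Proof. by rewrite dotvC dotvBl !(dotvC w). Qed.

Lemma dotvv_ge0 u : 0 <= dotv u u.
Proof. by rewrite dotvE sumr_ge0// => i _; rewrite -expr2 sqr_ge0. Qed.

Lemma norm2_ge0 u : 0 <= norm2 u.
Proof. exact: sqrtr_ge0. Qed.

Lemma norm2_sqr u : norm2 u ^+ 2 = dotv u u.
Proof. by rewrite /norm2 sqr_sqrtr// dotvv_ge0. Qed.

Lemma norm2_sqrE u : norm2 u ^+ 2 = \sum_i u 0 i ^+ 2.
Proof. by rewrite norm2_sqr dotvE. Qed.

Lemma norm2_eq0 u : norm2 u = 0 -> u = 0.
Proof.
move=> u0; have : \sum_i u 0 i ^+ 2 = 0 by rewrite -norm2_sqrE u0 expr0n.
move=> /psumr_eq0P H; apply/rowP => i; rewrite mxE.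
by apply/eqP; rewrite -sqrf_eq0 H// => k _; exact: sqr_ge0.
Qed.

Lemma norm2Z a u : norm2 (a *: u) = `|a| * norm2 u.
Proof.
by rewrite /norm2 dotvZl dotvZr mulrA -expr2 sqrtrM ?sqr_ge0// sqrtr_sqr.
Qed.

Lemma dot0v u : dotv 0 u = 0.
Proof. by rewrite /dotv mul0mx mxE. Qed.

Lemma cauchy_schwarz u v : dotv u v <= norm2 u * norm2 v.
Proof.
have [/norm2_eq0 ->|u0] := eqVneq (norm2 u) 0.
  by rewrite dot0v mulr_ge0// norm2_ge0.
have [/norm2_eq0 ->|v0] := eqVneq (norm2 v) 0.
  by rewrite dotvC dot0v mulr_ge0// norm2_ge0.
have uv0 : 0 < norm2 u * norm2 v by rewrite mulr_gt0// lt0r ?u0 ?v0 norm2_ge0.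
rewrite -subr_ge0 -(pmulr_rge0 _ uv0).
have := dotvv_ge0 (norm2 v *: u - norm2 u *: v).
rewrite !(dotvBl, dotvBr, dotvZl, dotvZr) -!norm2_sqr (dotvC v u); nra.
Qed.

Lemma norm2D u v : norm2 (u + v) <= norm2 u + norm2 v.
Proof.
rewrite -(@ler_pXn2r _ 2)// ?nnegrE ?addr_ge0 ?norm2_ge0//.
rewrite norm2_sqr !(dotvDl, dotvDr) -!norm2_sqr (dotvC v u).
have := cauchy_schwarz u v; nra.
Qed.

Lemma deriveE_grad (f : 'rV[R]_n -> R) x v : differentiable f x ->
  'D_v f x = dotv (grad f x) v.
Proof.
move=> df; rewrite deriveE// [in LHS](row_sum_delta v) linear_sum dotvE.
by apply: eq_bigr => i _; rewrite linearZ/= mxE deriveE// mulrC.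
Qed.

End euclidean.

(** * One step of the method *)

Section frank_wolfe_step.
Context (R : realType) (n : nat) (C : set 'rV[R]_n) (F : 'rV[R]_n -> R).
Hypothesis F_convex : convex_function (C : set (convex_lmodType 'rV[R]_n)) F.
Hypothesis F_diff : forall x, C x -> differentiable F x.

Lemma convex_segment x y s : C x -> C y -> 0 <= s <= 1 ->
  F ((1 - s) *: x + s *: y) <= (1 - s) * F x + s * F y.
Proof.
move=> Cx Cy /andP[s0 s1].
have := F_convex (Itv01 s0 s1) (mem_set Cy) (mem_set Cx).
by rewrite [(1 - s) *: x + _]addrC [(1 - s) * _ + _]addrC.
Qed.

(** The directional derivative at [x] is a limit of chord slopes, each at most
    [F y - F x] by convexity. *)
Lemma convex_gradient_le x y : C x -> C y ->
  dotv (grad F x) (y - x) <= F y - F x.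
Proof.
move=> Cx Cy; rewrite -deriveE_grad; last exact: F_diff.
have : h^-1 *: ((F \o shift x) (h *: (y - x)) - F x)
    @[h --> 0^'] --> 'D_(y - x) F x.
  by apply: diff_derivable; exact: F_diff.
move=> /cvg_dnbhs_at_right /cvgr_to_le; apply; near=> h.
have h0 : 0 < h by near: h; exact: nbhs_right_gt.
have h1 : h <= 1 by near: h; exact: nbhs_right_le.
rewrite /= /GRing.scale/= ler_pdivrMl//.
have := @convex_segment x y h Cx Cy.
rewrite (ltW h0) h1 => /(_ isT).
have -> : h *: (y - x) + x = (1 - h) *: x + h *: y.
  by rewrite scalerBr scalerBl scale1r [LHS]addrC addrCA [LHS]addrC.
lra.
Unshelve. all: by end_near. Qed.

Variables (D L : R).
Hypothesis C_diam : forall x y, C x -> C y -> norm2 (x - y) <= D.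
Hypothesis F_smooth : forall x y, C x -> C y ->
  norm2 (grad F x - grad F y) <= L * norm2 (x - y).

(** [L] itself may be negative when [C] is a single point. *)
Lemma smooth_abs x y : C x -> C y ->
  norm2 (grad F x - grad F y) <= `|L| * norm2 (x - y).
Proof.
move=> Cx Cy; apply: le_trans (F_smooth Cx Cy) _.
by rewrite ler_wpM2r ?norm2_ge0 ?ler_norm.
Qed.

(** Convexity at the new iterate bounds the decrease by a first-order term plus
    the variation of the gradient along the step, at most [`|L| * (g * D) ^+ 2].
    In the first-order term the gradient is traded for [d], for which [v] does at
    least as well as [xs], at the cost of the error [d - grad F x]; convexity at
    [x] bounds what is left by [F xs - F x]. *)
Lemma frank_wolfe_step (g : R) (x d v xs : 'rV[R]_n) :
  0 <= g -> C x -> C ((1 - g) *: x + g *: v) -> C xs ->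
  argmin C (dotv d) v ->
  F ((1 - g) *: x + g *: v) - F xs <=
    (1 - g) * (F x - F xs) + g * (D * norm2 (d - grad F x) + `|L| * D ^+ 2 * g).
Proof.
move=> g0 Cx; set y := _ + _ => Cy Cxs [Cv vmin].
have yx : y - x = g *: (v - x).
  rewrite /y scalerBl scale1r scalerBr addrAC [x - _ - x]addrAC subrr sub0r.
  by rewrite addrC.
have D0 : 0 <= D by have := C_diam Cx Cx; apply: le_trans; rewrite norm2_ge0.
have nyx : norm2 (y - x) <= g * D.
  by rewrite yx norm2Z ger0_norm// ler_wpM2l// C_diam.
have Fyx : F y - F x <=
    dotv (grad F y - grad F x) (y - x) + dotv (grad F x) (y - x).
  have := convex_gradient_le Cy Cx.
  by rewrite -(opprB y x) -scaleN1r dotvZr dotvBl; lra.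
have curvature : dotv (grad F y - grad F x) (y - x) <= `|L| * (g * D) ^+ 2.
  apply: le_trans (cauchy_schwarz _ _) _; rewrite expr2 [X in _ <= X]mulrA.
  apply: ler_pM; rewrite ?norm2_ge0//.
  by apply: le_trans (smooth_abs Cy Cx) _; rewrite ler_wpM2l.
have linear : dotv (grad F x) (v - x) <=
    dotv (grad F x - d) (v - xs) + (F xs - F x).
  have := convex_gradient_le Cx Cxs; have := vmin xs Cxs.
  by rewrite !(dotvBl, dotvBr); lra.
have error : dotv (grad F x - d) (v - xs) <= D * norm2 (d - grad F x).
  apply: le_trans (cauchy_schwarz _ _) _.
  rewrite -(opprB d) -scaleN1r norm2Z normrN1 mul1r mulrC.
  by rewrite ler_wpM2r ?norm2_ge0// C_diam.
have gl := ler_wpM2l g0 (le_trans linear (lerD error (lexx _))).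
move: Fyx gl curvature; rewrite {2}yx dotvZr exprMn expr2 => Fyx gl curvature.
lra.
Qed.

End frank_wolfe_step.

(** * Measurability of the stochastic gradient *)

Section borel_vectors.
Context (R : realType) (n : nat) (d : measure_display) (T : measurableType d).

Lemma open_borel (O : set 'rV[R]_n) :
  open O -> measurable (O : set (borel_rV R n)).
Proof. exact: sub_sigma_algebra. Qed.

Lemma closed_borel (K : set 'rV[R]_n) :
  closed K -> measurable (K : set (borel_rV R n)).
Proof.
by rewrite -openC => /open_borel/measurableC; rewrite setCK.
Qed.

Lemma measurable_coord (i : 'I_n) :
  measurable_fun setT (fun x : borel_rV R n => x 0 i).
Proof.
apply: (measurability (@RGenOpens.G R)); first exact: RGenOpens.measurableE.
move=> _ [_ [a [b ->]] <-]; rewrite setTI; apply: open_borel.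
apply: open_comp; last exact: interval_open.
by move=> x _; exact: coord_continuous.
Qed.

(** Every open set is a union of boxes with rational centers and radii [1/k.+1],
    of which there are countably many. *)
Lemma measurable_rowP (f : T -> borel_rV R n) :
  (forall i, measurable_fun setT (fun w => f w 0 i)) -> measurable_fun setT f.
Proof.
move=> mf.
apply: (@measurability _ _ T (borel_rV R n) setT f (@open 'rV[R]_n)) => //.
move=> _ [ O oO <-]; rewrite setTI.
pose c (q : 'rV[rat]_n) : 'rV[R]_n := map_mx ratr q.
pose box (p : 'rV[rat]_n * nat) := ball (c p.1) (p.2.+1%:R^-1 : R).
pose I := [set p | box p `<=` O].
have -> : O = \bigcup_(p in I) box p.
  apply/seteqP; split => [y Oy|y [p Ip]]; last exact: Ip.
  have /nbhs_ballP[e /= e0 yO] : nbhs y O by exact: open_nbhs_nbhs.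
  have [k ke] : exists k : nat, k.+1%:R^-1 < e / 2.
    exists (Num.trunc (e / 2)^-1); rewrite invf_plt ?posrE ?divr_gt0//.
    by rewrite Num.Theory.truncnS_gt.
  have k0 : 0 < k.+1%:R^-1 :> R by rewrite invr_gt0.
  have Hq i : exists q : rat, `|ratr q - y 0 i| < k.+1%:R^-1.
    have [|q] := @rat_in_itvoo _ (y 0 i - k.+1%:R^-1) (y 0 i + k.+1%:R^-1).
      by rewrite ltrBlDr -addrA ltrDl addr_gt0.
    by rewrite in_itv/= => yq; exists q; rewrite ltr_distl.
  pose q : 'rV[rat]_n := \row_i sval (cid (Hq i)).
  have yq : ball (c q) k.+1%:R^-1 y.
    split => // a b; rewrite !mxE ord1; exact: (svalP (cid (Hq b))).
  exists (q, k) => // x qx; apply: yO.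
  apply: (@le_ball _ _ _ (k.+1%:R^-1 + k.+1%:R^-1)).
    by rewrite [leRHS]splitr lerD// ltW.
  exact: ball_triangle (ball_sym yq) qx.
rewrite preimage_bigcup bigcup_mkcond.
apply: countable_bigcupT_measurable => // p; case: ifP => // _.
have -> : f @^-1` box p =
    \bigcap_(i in [set: 'I_n]) [set w | `|c p.1 0 i - f w 0 i| < p.2.+1%:R^-1].
  apply/seteqP; split => w /=.
    by move=> [_ H] i _; exact: (H 0 i).
  by move=> H; split; [rewrite invr_gt0|move=> a i; rewrite ord1; exact: H].
apply: fin_bigcap_measurable => [|i _]; first exact: finite_finset.
have := @measurable_funB _ _ _ setT (cst (c p.1 0 i)) _
  (measurable_cst _) (mf i).
move=> /(measurableT_comp (@normr_measurable R setT)).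
move=> /(_ measurableT _ (measurable_itv `]-oo, p.2.+1%:R^-1[)).
rewrite setTI; congr measurable; apply/seteqP; split => w /=; by rewrite in_itv.
Qed.

End borel_vectors.

Section measurable_gradient.
Context (R : realType) (n : nat) (dZ : measure_display) (Z : measurableType dZ).
Variables (Ftilde : 'rV[R]_n -> Z -> R) (U C : set 'rV[R]_n).
Hypotheses (U_open : open U) (subCU : C `<=` U) (C_compact : compact C).
Hypothesis Ftilde_meas : measurable_fun
  ((U : set (borel_rV R n)) `*` [set: Z])
  (fun p : borel_rV R n * Z => Ftilde p.1 p.2).
Hypothesis Ftilde_diff : forall x z, C x -> differentiable (Ftilde ^~ z) x.

Lemma measurable_compact : measurable (C : set (borel_rV R n)).
Proof.
by apply: closed_borel; apply: compact_closed => //; exact: norm_hausdorff.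
Qed.

(** Each partial derivative is a pointwise limit on [C] of difference
    quotients; extending [Ftilde] by [0] outside [U] makes these quotients
    measurable everywhere without changing the limit, [U] being open. *)
Lemma measurable_grad_coord (i : 'I_n) : measurable_fun
  ((C : set (borel_rV R n)) `*` [set: Z])
  (fun p : borel_rV R n * Z => grad (Ftilde ^~ p.2) p.1 0 i).
Proof.
have mUT : measurable ((U : set (borel_rV R n)) `*` [set: Z]).
  by apply: measurableX => //; exact: open_borel.
pose f0 : borel_rV R n * Z -> R :=
  (fun p => Ftilde p.1 p.2) \_ ((U : set (borel_rV R n)) `*` setT).
have mf0 : measurable_fun setT f0.
  have [m0 _] := measurable_restrictT
    (fun p : borel_rV R n * Z => Ftilde p.1 p.2) mUT.
  exact: m0.
pose e k : R := k.+1%:R^-1.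
have e_gt0 k : 0 < e k by rewrite invr_gt0.
pose sh k (p : borel_rV R n * Z) : borel_rV R n * Z :=
  (((e k *: delta_mx 0 i : 'rV[R]_n) + (p.1 : 'rV[R]_n))%R : borel_rV R n, p.2).
have msh k : measurable_fun setT (sh k).
  apply: measurable_fun_pair => //; apply: measurable_rowP => j.
  under eq_fun do rewrite mxE.
  apply: measurable_funD => //.
  exact: (measurableT_comp (measurable_coord j) measurable_fst).
apply: (@measurable_fun_cvg _ _ _ _
  (fun k p => (e k)^-1 * (f0 (sh k p) - f0 p))).
  move=> k; apply: measurable_funTS; apply: measurable_funM => //.
  by apply: measurable_funB => //; exact: measurableT_comp.
move=> [x z] [/= Cx _]; rewrite mxE.
have : h^-1 *: (((Ftilde ^~ z) \o shift x) (h *: delta_mx 0 i) - Ftilde x z)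
    @[h --> 0^'] --> 'D_(delta_mx 0 i) (Ftilde ^~ z) x.
  by apply: diff_derivable; exact: Ftilde_diff.
move=> /cvg_dnbhs_at_right /cvg_at_rightP /(_ e (conj e_gt0 cvg_harmonic)).
apply: cvg_trans; apply: near_eq_cvg.
have f0E y : U y -> f0 (y, z) = Ftilde y z.
  by move=> Uy; rewrite /f0 patchE in_setX in_setT andbT mem_set.
have Ux : \forall k \near \oo, U (e k *: delta_mx 0 i + x).
  have : (e k *: delta_mx 0 i + x) @[k --> \oo] --> 0 *: delta_mx 0 i + x.
    apply: cvgD; last exact: cvg_cst.
    apply: cvgZr_tmp; exact: cvg_harmonic.
  rewrite scale0r add0r; apply; exact: open_nbhs_nbhs (conj U_open (subCU Cx)).
near=> k.
have Uk : U (e k *: delta_mx 0 i + x) by near: k.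
by rewrite /= /sh/= (f0E _ Uk) (f0E _ (subCU Cx)).
Unshelve. all: by end_near. Qed.

(** Cut off outside [C], where the partial derivatives need not exist. *)
Definition sgrad (i : 'I_n) (p : borel_rV R n * Z) : R :=
  ((fun p : borel_rV R n * Z => grad (Ftilde ^~ p.2) p.1 0 i)
     \_ ((C : set (borel_rV R n)) `*` setT)) p.

Lemma measurable_sgrad i : measurable_fun setT (sgrad i).
Proof.
have mCT : measurable ((C : set (borel_rV R n)) `*` [set: Z]).
  by apply: measurableX => //; exact: measurable_compact.
have [m _] := measurable_restrictT
  (fun p : borel_rV R n * Z => grad (Ftilde ^~ p.2) p.1 0 i) mCT.
exact: m (measurable_grad_coord i).
Qed.

Lemma sgradE i x z : C x -> sgrad i (x, z) = grad (Ftilde ^~ z) x 0 i.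
Proof.
by move=> Cx; rewrite /sgrad patchE in_setX in_setT andbT mem_set.
Qed.

Variable P : probability Z R.
Hypothesis unbiased : forall x, C x -> forall i : 'I_n,
  ('E_P[(fun z => grad (Ftilde ^~ z) x 0 i)%R]
     = (grad (expected_fun P Ftilde) x 0 i)%:E)%E.

(** On [C] the gradient of [F] is the expectation of the stochastic gradient,
    and the integrals of its positive and negative parts over the sample are
    measurable in the point by Tonelli's theorem. *)
Lemma measurable_expected_grad i : measurable_fun (C : set (borel_rV R n))
  (fun x : borel_rV R n => grad (expected_fun P Ftilde) x 0 i).
Proof.
pose G (p : borel_rV R n * Z) := (sgrad i p)%:E.
have mG : measurable_fun setT G.
  by apply/measurable_EFinP; exact: measurable_sgrad.
apply/measurable_EFinP.
apply: (@eq_measurable_fun _ _ _ _ _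
  (fubini_F P G^\+ \- fubini_F P G^\-)%E).
  move=> x /set_mem Cx; rewrite /= -unbiased//.
  rewrite [in RHS]unlock [RHS]integralE /fubini_F.
  have GE z : G (x, z) = (grad (Ftilde ^~ z) x 0 i)%:E by rewrite /G sgradE.
  by congr (_ - _)%E; apply: eq_integral => z _;
    rewrite !(funeposE, funenegE) GE.
apply: measurable_funTS; apply: emeasurable_funB.
  by apply: measurable_fun_fubini_tonelli_F => //; exact: measurable_funepos.
by apply: measurable_fun_fubini_tonelli_F => //; exact: measurable_funeneg.
Qed.

End measurable_gradient.

(** * The error of the gradient estimate *)

Section second_moment.
Context (R : realType) (n : nat) (dZ : measure_display) (Z : measurableType dZ)
  (P : probability Z R).
Variable xi : Z -> 'rV[R]_n.
Hypothesis mxi : forall i, measurable_fun setT (fun y => xi y 0 i).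

Lemma measurable_norm2_sqr d (T : measurableType d) (f : T -> 'rV[R]_n) :
  (forall i, measurable_fun setT (fun w => f w 0 i)) ->
  measurable_fun setT (fun w => norm2 (f w) ^+ 2).
Proof.
move=> mf; under eq_fun do rewrite norm2_sqrE.
by apply: measurable_sum => i; apply: measurable_funX.
Qed.

Variable s : R.
Hypothesis xi_var : (\int[P]_y (norm2 (xi y) ^+ 2)%:E <= s%:E)%E.

Let int_sqr : P.-integrable setT (fun y => (norm2 (xi y) ^+ 2)%:E).
Proof.
apply/integrableP; split.
  by apply/measurable_EFinP; exact: measurable_norm2_sqr.
under eq_integral do rewrite gee0_abs ?lee_fin ?sqr_ge0//.
by apply: le_lt_trans xi_var _; rewrite ltry.
Qed.

Lemma integrable_coord i : P.-integrable setT (fun y => (xi y 0 i)%:E).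
Proof.
(* [`|a| <= 1 + a ^+ 2] for every real [a] *)
apply: (@le_integrable _ _ _ _ _ _ _
  (fun y => 1%:E + (norm2 (xi y) ^+ 2)%:E)%E) => //.
- exact/measurable_EFinP.
- move=> y _ /=; rewrite lee_fin [leRHS]ger0_norm ?addr_ge0 ?sqr_ge0//.
  rewrite norm2_sqrE (bigD1 i)//=.
  have : 0 <= \sum_(j | j != i) xi y 0 j ^+ 2.
    by apply: sumr_ge0 => j _; exact: sqr_ge0.
  by rewrite ler_norml; nra.
- by apply: integrableD => //; exact: finite_measure_integrable_cst.
Qed.

Hypothesis xi_mean0 : forall i, (\int[P]_y (xi y 0 i)%:E = 0)%E.

(** The cross terms vanish because the noise is centered. *)
Lemma second_moment_shift_le (u : 'rV[R]_n) (r : R) :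
  (\int[P]_y (norm2 (u + r *: xi y) ^+ 2)%:E
     <= (norm2 u ^+ 2 + r ^+ 2 * s)%:E)%E.
Proof.
have E y : (norm2 (u + r *: xi y) ^+ 2)%:E =
    ((norm2 u ^+ 2)%:E + (\sum_i (2 * r * u 0 i)%:E * (xi y 0 i)%:E +
     (r ^+ 2)%:E * (norm2 (xi y) ^+ 2)%:E))%E.
  rewrite !norm2_sqrE -[in RHS]EFinM sumEFin -!EFinD; congr EFin.
  rewrite mulr_sumr -!big_split/=; apply: eq_bigr => i _.
  by rewrite !mxE; ring.
under eq_integral do rewrite E.
have int_cross i :
    P.-integrable setT (fun y => (2 * r * u 0 i)%:E * (xi y 0 i)%:E)%E.
  by apply: integrableZl => //; exact: integrable_coord.
have int_cross_sum : P.-integrable setT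
    (fun y => \sum_i (2 * r * u 0 i)%:E * (xi y 0 i)%:E)%E.
  exact: integrable_sum.
have int_r :
    P.-integrable setT (fun y => (r ^+ 2)%:E * (norm2 (xi y) ^+ 2)%:E)%E.
  exact: integrableZl.
rewrite integralD//; last 2 first.
- exact: finite_measure_integrable_cst.
- exact: integrableD.
rewrite integralD// integral_cst// [X in (_ * X + _)%E](_ : _ = 1%E); last first.
  exact: probability_setT.
rewrite mule1 integral_sum//.
rewrite big1 => [|i _]; last first.
  by rewrite integralZl ?xi_mean0 ?mule0//; exact: integrable_coord.
rewrite add0e integralZl// EFinD leeD2l// [in leRHS]EFinM.
by apply: lee_wpmul2l => //; rewrite lee_fin sqr_ge0.
Qed.

End second_moment.

(** [(1 - r) * (a + c)] is the convex combination of [a] and [(1 - r) * (c / r)]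
    with weights [1 - r] and [r]; the square is convex and [(1 - r) ^+ 2 <= 1]. *)
Lemma momentum_step_le (R : realType) (r a c m s : R) :
  0 < r <= 1 -> 0 <= m -> m <= a + c ->
  (1 - r) ^+ 2 * m ^+ 2 + s <= (1 - r) * a ^+ 2 + (c ^+ 2 / r + s).
Proof.
move=> /andP[r0 r1] m0 mac; rewrite addrA lerD2r.
apply: (@le_trans _ _ ((1 - r) ^+ 2 * (a + c) ^+ 2)).
  by apply: ler_wpM2l; [exact: sqr_ge0|rewrite lerXn2r// nnegrE (le_trans m0)].
pose t := c / r.
have -> : c = r * t by rewrite mulrC divfK// gt_eqF.
have -> : (r * t) ^+ 2 / r = r * t ^+ 2.
  by field; rewrite gt_eqF.
have H1 : 0 <= r * (1 - r) * (a - (1 - r) * t) ^+ 2.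
  by rewrite mulr_ge0 ?sqr_ge0// mulr_ge0 ?subr_ge0// ltW.
have H2 : 0 <= r * t ^+ 2 * (1 - (1 - r) ^+ 2).
  apply: mulr_ge0; first by rewrite mulr_ge0 ?sqr_ge0 ?(ltW r0).
  by rewrite subr_ge0 expr_le1 ?subr_ge0// gerBl ltW.
rewrite -subr_ge0.
suff -> : (1 - r) * a ^+ 2 + r * t ^+ 2 - (1 - r) ^+ 2 * (a + r * t) ^+ 2 =
  r * (1 - r) * (a - (1 - r) * t) ^+ 2 + r * t ^+ 2 * (1 - (1 - r) ^+ 2).
  exact: addr_ge0.
ring.
Qed.

(** Valid for every [r], so that expectations stay finite during the first
    steps, where [rho] may exceed [1]. *)
Lemma crude_step_le (R : realType) (r a c m s : R) :
  0 <= m -> m <= a + c ->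
  (1 - r) ^+ 2 * m ^+ 2 + s <=
    2 * (1 - r) ^+ 2 * a ^+ 2 + (2 * (1 - r) ^+ 2 * c ^+ 2 + s).
Proof.
move=> m0 mac; rewrite addrA lerD2r.
apply: (@le_trans _ _ ((1 - r) ^+ 2 * (a + c) ^+ 2)).
  by apply: ler_wpM2l; [exact: sqr_ge0|rewrite lerXn2r// nnegrE (le_trans m0)].
have : 0 <= (1 - r) ^+ 2 * (a - c) ^+ 2 by rewrite mulr_ge0 ?sqr_ge0.
nra.
Qed.

(** * Convergence of the method *)

Section stochastic_frank_wolfe.
Context (R : realType) (n : nat) (C : set 'rV[R]_n).
Hypotheses (C_compact : compact C)
  (C_convex : convex_set (C : set (convex_lmodType 'rV[R]_n))).
Context (dZ : measure_display) (Z : measurableType dZ) (P : probability Z R).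
Variables (Ftilde : 'rV[R]_n -> Z -> R) (U : set 'rV[R]_n).
Hypotheses (U_open : open U) (subCU : C `<=` U).
Hypothesis Ftilde_meas : measurable_fun
  ((U : set (borel_rV R n)) `*` [set: Z])
  (fun p : borel_rV R n * Z => Ftilde p.1 p.2).
Hypothesis Ftilde_diff : forall x z, C x -> differentiable (Ftilde ^~ z) x.
Variables (D L sigma : R).
Hypothesis C_diam : forall x y, C x -> C y -> norm2 (x - y) <= D.
Local Notation F := (expected_fun P Ftilde).
Hypothesis F_smooth : forall x y, C x -> C y ->
  norm2 (grad F x - grad F y) <= L * norm2 (x - y).
Hypothesis unbiased : forall x, C x -> forall i : 'I_n,
  ('E_P[(fun z => grad (Ftilde ^~ z) x 0 i)%R] = (grad F x 0 i)%:E)%E.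
Hypothesis variance : forall x, C x ->
  ('E_P[(fun z => norm2 (grad (Ftilde ^~ z) x - grad F x) ^+ 2)%R]
     <= (sigma ^+ 2)%:E)%E.
Variables rho gamma : nat -> R.
Hypothesis rho_gt0 : forall t, 0 < rho t.
Hypothesis gamma_gt0_le1 : forall t, 0 < gamma t <= 1.
Context (dW : measure_display) (W : measurableType dW) (Q : probability W R).
Variable z : nat -> {RV Q >-> Z}.
Hypothesis z_iid : iid_samples P (fun k => z k.+1).
Variables (x0 : 'rV[R]_n) (x d v : nat -> W -> 'rV[R]_n).
Hypotheses (x0_in : C x0) (sfw : is_SFW C Ftilde rho gamma x0 z x d v).

Lemma convex_mem x1 x2 s : C x1 -> C x2 -> 0 <= s <= 1 ->
  C ((1 - s) *: x1 + s *: x2).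
Proof.
move=> C1 C2 /andP[s0 s1].
have := C_convex (Itv01 s0 s1) (mem_set C2) (mem_set C1).
by rewrite inE /conv/= addrC.
Qed.

Lemma iterate_mem t w : C (x t w).
Proof.
elim: t => [|t IH]; first by rewrite (SFW_x0 sfw).
rewrite (SFW_x sfw); apply: convex_mem => //.
  by have [] := SFW_v sfw t w.
by have /andP[g0 g1] := gamma_gt0_le1 t.+1; rewrite (ltW g0).
Qed.

Lemma measurable_iterate_coord t i :
  measurable_fun setT (fun w : pastType z t => x t.+1 w 0 i).
Proof.
have mv s : measurable_fun setT (fun w : pastType z s => v s w 0 i).
  apply: (measurableT_comp (measurable_coord i)) => _ B mB.
  by rewrite setTI measurable_pastE; exact: (SFW_v_adapted sfw mB).
elim: t => [|t IH].
  under eq_fun do rewrite (SFW_x sfw) (SFW_x0 sfw) addv_coord !scalev_coord.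
  by apply: measurable_funD => //; apply: measurable_funM.
under eq_fun do rewrite (SFW_x sfw) addv_coord !scalev_coord.
apply: measurable_funD; apply: measurable_funM => //.
exact: (measurable_past_funS IH).
Qed.

Lemma measurable_iterate t :
  measurable_fun setT (x t.+1 : pastType z t -> borel_rV R n).
Proof. by apply: measurable_rowP => i; exact: measurable_iterate_coord. Qed.

Lemma measurable_direction_coord t i :
  measurable_fun setT (fun w : pastType z t => d t w 0 i).
Proof.
elim: t => [|t IH].
  by under eq_fun do rewrite (SFW_d0 sfw) mxE; exact: measurable_cst.
have -> : (fun w => d t.+1 w 0 i) = (fun w => (1 - rho t.+1) * d t w 0 i +
    rho t.+1 * sgrad Ftilde C i (x t.+1 w, z t.+1 w)).
  apply/funext => w; rewrite (SFW_d sfw) sgradE; last exact: iterate_mem.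
  by rewrite addv_coord !scalev_coord.
apply: measurable_funD; apply: measurable_funM => //.
  exact: (measurable_past_funS IH).
apply: (measurableT_comp
  (measurable_sgrad U_open subCU C_compact Ftilde_meas Ftilde_diff i)).
apply: measurable_fun_pair; last exact: measurable_past_sample.
exact: (measurable_past_funS (@measurable_iterate t)).
Qed.

Lemma measurable_grad_iterate_coord t i :
  measurable_fun setT (fun w : pastType z t => grad F (x t.+1 w) 0 i).
Proof.
apply: (@measurable_comp _ _ _ _ _ _ (C : set (borel_rV R n))
  (fun y => grad F y 0 i)).
- exact: measurable_compact C_compact.
- by move=> _ [w _ <-]; exact: iterate_mem.
- exact: (measurable_expected_grad U_open subCU C_compact Ftilde_meas
    Ftilde_diff unbiased).
- exact: measurable_iterate.
Qed.

Definition err t w : R := norm2 (d t w - grad F (x t w)) ^+ 2.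

Lemma measurable_err t : measurable_fun setT (err t : pastType z t -> R).
Proof.
apply: measurable_norm2_sqr => i.
under eq_fun do rewrite subv_coord.
apply: measurable_funB; first exact: measurable_direction_coord.
case: t => [|t].
  by under eq_fun do rewrite (SFW_x0 sfw); exact: measurable_cst.
exact: (measurable_past_funS (@measurable_grad_iterate_coord t i)).
Qed.

Lemma err_ge0 t w : 0 <= err t w.
Proof. exact: sqr_ge0. Qed.

Let noise t w y : 'rV[R]_n :=
  \row_i sgrad Ftilde C i (x t.+1 w, y) - grad F (x t.+1 w).

Let noiseE t w y :
  noise t w y = grad (Ftilde ^~ y) (x t.+1 w) - grad F (x t.+1 w).
Proof.
congr (_ - _); apply/rowP => i; rewrite mxE sgradE//; exact: iterate_mem.
Qed.

Let measurable_noise t i :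
  measurable_fun setT (fun p : pastType z t * Z => noise t p.1 p.2 0 i).
Proof.
under eq_fun do rewrite subv_coord [in X in X - _]mxE.
apply: measurable_funB; last first.
  exact: (measurableT_comp (@measurable_grad_iterate_coord t i) measurable_fst).
apply: (measurableT_comp
  (measurable_sgrad U_open subCU C_compact Ftilde_meas Ftilde_diff i)).
apply: measurable_fun_pair => //.
exact: (measurableT_comp (@measurable_iterate t) measurable_fst).
Qed.

Let measurable_noise_section t w i :
  measurable_fun setT (fun y => noise t w y 0 i).
Proof.
have := @measurable_fun_pair2 _ _ _ (pastType z t) Z R
  (fun p => noise t p.1 p.2 0 i) w (@measurable_noise t i).
exact.
Qed.

Let noise_var t w :
  (\int[P]_y (norm2 (noise t w y) ^+ 2)%:E <= (sigma ^+ 2)%:E)%E.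
Proof.
apply: le_trans (variance (iterate_mem t.+1 w)); rewrite [in leRHS]unlock.
by under eq_integral do rewrite noiseE.
Qed.

Let noise_mean0 t w i : (\int[P]_y (noise t w y 0 i)%:E = 0)%E.
Proof.
have int_noise :=
  integrable_coord (measurable_noise_section t w) (noise_var t w) i.
have := unbiased (iterate_mem t.+1 w) i; rewrite [in X in X -> _]unlock.
have -> : (\int[P]_y (grad (Ftilde ^~ y) (x t.+1 w) 0 i)%:E =
    \int[P]_y ((noise t w y 0 i)%:E + (grad F (x t.+1 w) 0 i)%:E))%E.
  apply: eq_integral => y _; rewrite noiseE -EFinD; congr EFin.
  by rewrite subv_coord subrK.
rewrite integralD//; last exact: finite_measure_integrable_cst.
rewrite integral_cst// [X in (_ * X)%E](_ : _ = 1%E) ?mule1; last first.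
  exact: probability_setT.
have /fineK <- : (\int[P]_y (noise t w y 0 i)%:E)%E \is a fin_num.
  exact: integrable_fin_num.
by rewrite -EFinD => -[]; move/(canRL (addrK _)); rewrite subrr => ->.
Qed.

(** Given the past, the new direction is a fixed vector plus [rho t.+1] times a
    centered noise of variance at most [sigma ^+ 2]. *)
Lemma err_step t A : past z t A ->
  (\int[Q]_(w in A) (err t.+1 w)%:E <=
   \int[Q]_(w in A) ((1 - rho t.+1) ^+ 2 *
     norm2 (d t w - grad F (x t.+1 w)) ^+ 2 + rho t.+1 ^+ 2 * sigma ^+ 2)%:E)%E.
Proof.
move=> pA; set r := rho t.+1.
pose u w := (1 - r) *: (d t w - grad F (x t.+1 w)).
have mu i : measurable_fun setT (fun w : pastType z t => u w 0 i).
  under eq_fun do rewrite scalev_coord subv_coord.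
  apply: measurable_funM => //; apply: measurable_funB.
    exact: measurable_direction_coord.
  exact: measurable_grad_iterate_coord.
pose H (p : pastType z t * Z) := (norm2 (u p.1 + r *: noise t p.1 p.2) ^+ 2)%:E.
have mH : measurable_fun setT H.
  apply/measurable_EFinP; apply: measurable_norm2_sqr => i.
  under eq_fun do rewrite addv_coord [X in _ + X]scalev_coord.
  apply: measurable_funD.
    exact: (measurableT_comp (mu i) measurable_fst).
  by apply: measurable_funM => //; exact: measurable_noise.
have H0 p : (0 <= H p)%E by rewrite lee_fin sqr_ge0.
have -> : (\int[Q]_(w in A) (err t.+1 w)%:E =
    \int[Q]_(w in A) H (w, z t.+1 w))%E.
  apply: eq_integral => w _; rewrite /H /err /u /= noiseE (SFW_d sfw) -/r.
  congr (norm2 _ ^+ 2)%:E; apply/rowP => i.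
  rewrite !(subv_coord, addv_coord, scalev_coord).
  by ring.
rewrite (integral_next_sample z_iid pA mH H0).
have mA := past_measurable pA.
apply: ge0_le_integral => //.
- by move=> w _; apply: integral_ge0.
- have mFH := measurable_fun_fubini_tonelli_F (m2 := P) H mH H0.
  exact: (measurable_funTS (measurable_past_fun mFH)).
- apply/measurable_EFinP/measurable_funTS.
  apply: (@measurable_past_fun _ _ _ _ _ _ z _ _ t); apply: measurable_funD => //.
  apply: measurable_funM => //; apply: measurable_norm2_sqr => i.
  under eq_fun do rewrite subv_coord.
  apply: measurable_funB; first exact: measurable_direction_coord.
  exact: measurable_grad_iterate_coord.
move=> w _; rewrite /H/=.
apply: le_trans (second_moment_shift_le _ (noise_var t w) _ _ _) _.
- exact: measurable_noise_section.
- by move=> i; exact: noise_mean0.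
by rewrite norm2Z exprMn real_normK// num_real.
Qed.

(* [c t] bounds the change of the gradient when moving to [x t], and [b t] is
   what this change and the noise add to the expected squared error. *)
Let c t := `|L| * (gamma t * D).
Let b t := c t ^+ 2 / rho t + rho t ^+ 2 * sigma ^+ 2.

Lemma drift_le t w : norm2 (d t w - grad F (x t.+1 w)) <=
  norm2 (d t w - grad F (x t w)) + c t.+1.
Proof.
have -> : d t w - grad F (x t.+1 w) =
    (d t w - grad F (x t w)) + (grad F (x t w) - grad F (x t.+1 w)).
  by rewrite addrA subrK.
apply: le_trans (norm2D _ _) _; rewrite lerD2l.
apply: le_trans (smooth_abs F_smooth (iterate_mem t w) (iterate_mem t.+1 w)) _.
rewrite ler_wpM2l// (SFW_x sfw) scalerBl scale1r.
have -> : x t w - (x t w - gamma t.+1 *: x t w + gamma t.+1 *: v t w) =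
    gamma t.+1 *: (x t w - v t w).
  apply/rowP => i; rewrite !(subv_coord, addv_coord, scalev_coord). ring.
have /andP[g0 _] := gamma_gt0_le1 t.+1.
rewrite norm2Z gtr0_norm//; apply: ler_wpM2l; first exact: ltW.
apply: C_diam; first exact: iterate_mem.
by have [] := SFW_v sfw t w.
Qed.

Let measurable_err_on t A : past z t A -> measurable_fun A (err t).
Proof.
move=> pA; exact: (measurable_funTS (measurable_past_fun (@measurable_err t))).
Qed.

Let err_step_affine t A (a k : R) : past z t A ->
  (forall w, (1 - rho t.+1) ^+ 2 * norm2 (d t w - grad F (x t.+1 w)) ^+ 2 +
     rho t.+1 ^+ 2 * sigma ^+ 2 <= a * err t w + k) ->
  (\int[Q]_(w in A) (err t.+1 w)%:E <= \int[Q]_(w in A) (a * err t w + k)%:E)%E.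
Proof.
move=> pA le_ak; apply: le_trans (err_step pA) _.
have mA := past_measurable pA.
have ge0 w : 0 <= (1 - rho t.+1) ^+ 2 * norm2 (d t w - grad F (x t.+1 w)) ^+ 2 +
     rho t.+1 ^+ 2 * sigma ^+ 2.
  by rewrite addr_ge0// mulr_ge0// sqr_ge0.
apply: ge0_le_integral => //.
- by move=> w _; rewrite lee_fin ge0.
- apply/measurable_EFinP/measurable_funTS.
  apply: (@measurable_past_fun _ _ _ _ _ _ z _ _ t); apply: measurable_funD => //.
  apply: measurable_funM => //; apply: measurable_norm2_sqr => i.
  under eq_fun do rewrite subv_coord.
  apply: measurable_funB; first exact: measurable_direction_coord.
  exact: measurable_grad_iterate_coord.
- apply/measurable_EFinP; apply: measurable_funD => //.
  apply: measurable_funM => //.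
  exact: measurable_err_on.
- by move=> w _; rewrite lee_fin.
Qed.

Lemma err_contraction t A : past z t A -> rho t.+1 <= 1 ->
  (\int[Q]_(w in A) (err t.+1 w)%:E <=
   \int[Q]_(w in A) ((1 - rho t.+1) * err t w + b t.+1)%:E)%E.
Proof.
move=> pA r1; apply: err_step_affine => // w.
apply: momentum_step_le (norm2_ge0 _) (drift_le t w).
by rewrite rho_gt0.
Qed.

Lemma err_integrable t : (\int[Q]_w (err t w)%:E < +oo)%E.
Proof.
have pT s : past z s setT.
  by rewrite -measurable_pastE.
elim: t => [|t IH].
  rewrite (eq_integral (fun=> (norm2 (- grad F x0) ^+ 2)%:E)); last first.
    by move=> w _; rewrite /err (SFW_d0 sfw) (SFW_x0 sfw) sub0r.
  rewrite integral_cst// lte_mul_pinfty ?lee_fin ?sqr_ge0//.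
  by rewrite -ge0_fin_numE// fin_num_measure.
pose a := 2 * (1 - rho t.+1) ^+ 2.
pose k := a * c t.+1 ^+ 2 + rho t.+1 ^+ 2 * sigma ^+ 2.
have a0 : 0 <= a by rewrite mulr_ge0// sqr_ge0.
have k0 : 0 <= k by rewrite addr_ge0// mulr_ge0// sqr_ge0.
have step : (\int[Q]_w (err t.+1 w)%:E <= \int[Q]_w (a * err t w + k)%:E)%E.
  apply: err_step_affine => // w.
  exact: crude_step_le (norm2_ge0 _) (drift_le t w).
apply: le_lt_trans step _.
have merr := measurable_err_on (pT t).
under eq_integral do rewrite EFinD EFinM.
rewrite ge0_integralD//; last 2 first.
- by move=> w _; rewrite mule_ge0// lee_fin err_ge0.
- by apply: measurable_funeM; apply/measurable_EFinP.
rewrite ge0_integralZl//; last 2 first.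
- exact/measurable_EFinP.
- by move=> w _; rewrite lee_fin err_ge0.
rewrite integral_cst//= lte_add_pinfty// lte_mul_pinfty//.
by rewrite -ge0_fin_numE// fin_num_measure.
Qed.

Hypothesis sum_rho : (\sum_(0 <= t <oo) (rho t)%:E = +oo)%E.
Hypothesis sum_rho2 : (\sum_(0 <= t <oo) (rho t ^+ 2)%:E < +oo)%E.
Hypothesis sum_gamma2_rho :
  (\sum_(0 <= t <oo) (gamma t ^+ 2 / rho t)%:E < +oo)%E.

Let b_ge0 t : 0 <= b t.
Proof.
rewrite addr_ge0//; first by rewrite divr_ge0 ?sqr_ge0// ltW.
by rewrite mulr_ge0// sqr_ge0.
Qed.

Let summable_b : (\sum_(0 <= t <oo) (b t)%:E < +oo)%E.
Proof.
have bE t : (b t)%:E = (((`|L| * D) ^+ 2)%:E * (gamma t ^+ 2 / rho t)%:E +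
    (sigma ^+ 2)%:E * (rho t ^+ 2)%:E)%E.
  by rewrite -!EFinM -EFinD; congr EFin; rewrite /b /c; ring.
have gr0 t : (0 <= (gamma t ^+ 2 / rho t)%:E)%E.
  by rewrite lee_fin divr_ge0 ?sqr_ge0// ltW.
have r20 t : (0 <= (rho t ^+ 2)%:E)%E by rewrite lee_fin sqr_ge0.
rewrite (eq_eseriesr (fun t _ => bE t)) nneseriesD; last 2 first.
- by move=> t _ _; rewrite mule_ge0// lee_fin sqr_ge0.
- by move=> t _ _; rewrite mule_ge0// lee_fin sqr_ge0.
rewrite !nneseriesZl// lte_add_pinfty// lte_mul_pinfty// ?lee_fin ?sqr_ge0//.
Qed.

Let rho_cvg0 : rho @ \oo --> (0 : R).
Proof.
by apply/sqr_cvg0/summable_cvg0 => // t; exact: sqr_ge0.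
Qed.

Let rho_le1 : exists T, forall t, (T <= t)%N -> rho t <= 1.
Proof.
have /cvgrPdist_le/(_ 1 ltr01)[T _ TH] := rho_cvg0.
exists T => t /TH; rewrite sub0r normrN => /(le_trans (ler_norm _)); exact.
Qed.

Lemma err_cvg0 : {ae Q, forall w, err ^~ w @ \oo --> (0 : R)}.
Proof.
have [T rT] := rho_le1.
apply: (@almost_supermartingale_cvg0 _ _ _ Q (past z) err rho b T) => //.
- exact: past_sigma_algebra.
- exact: past_measurable.
- exact: pastS.
- exact: err_ge0.
- move=> t l; rewrite -measurable_pastE.
  have -> : [set w | l <= err t w] =
      (err t : pastType z t -> R) @^-1` `[l, +oo[.
    by apply/seteqP; split => w /=; rewrite in_itv/= andbT.
  by rewrite -[_ @^-1` _]setTI; apply: measurable_err.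
- exact: err_integrable.
- by move=> t; exact: ltW.
- move=> t A Tt pA; apply: err_contraction => //.
  by apply: rT; exact: leqW.
Qed.

Hypothesis F_convex :
  convex_function (C : set (convex_lmodType 'rV[R]_n)) F.
Hypothesis F_diff : forall y, C y -> differentiable F y.
Hypothesis sum_gamma : (\sum_(0 <= t <oo) (gamma t)%:E = +oo)%E.
Variable xstar : 'rV[R]_n.
Hypothesis xstar_min : argmin C F xstar.

Let gamma_cvg0 : gamma @ \oo --> (0 : R).
Proof.
apply: sqr_cvg0.
have gr : (fun t => gamma t ^+ 2 / rho t) @ \oo --> (0 : R).
  apply: summable_cvg0 => // t.
  by rewrite divr_ge0 ?sqr_ge0// ltW.
have -> : (fun t => gamma t ^+ 2) = (fun t => gamma t ^+ 2 / rho t * rho t).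
  by apply/funext => t; rewrite divfK ?gt_eqF.
by rewrite -(mulr0 0); apply: cvgM; [exact: gr|exact: rho_cvg0].
Qed.

(** Along a path on which the direction error vanishes, the optimality gap is
    a relaxation towards a vanishing forcing term. *)
Lemma gap_cvg0 w : err ^~ w @ \oo --> (0 : R) ->
  (fun t => F (x t w) - F xstar) @ \oo --> (0 : R).
Proof.
move=> err0; have [Cs smin] := xstar_min.
pose delta t := norm2 (d t w - grad F (x t w)).
have delta0 : delta @ \oo --> (0 : R) by exact: sqr_cvg0.
pose eps t := D * delta t + `|L| * D ^+ 2 * gamma t.+1.
apply: (@relaxation_cvg0 _ gamma _ eps 0) => //.
- by move=> t; have /andP[/ltW] := gamma_gt0_le1 t.
- by move=> t _; have /andP[] := gamma_gt0_le1 t.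
- by move=> t; rewrite subr_ge0; apply: smin; exact: iterate_mem.
- have -> : 0 = D * 0 + `|L| * D ^+ 2 * 0 :> R by rewrite !mulr0 addr0.
  apply: cvgD; apply: cvgM => //; try exact: cvg_cst.
  by move: gamma_cvg0; rewrite -cvg_shiftS.
- move=> t _; have /andP[/ltW g0 _] := gamma_gt0_le1 t.+1.
  have Cx := iterate_mem t w; have := iterate_mem t.+1 w.
  rewrite (SFW_x sfw) => Cx'.
  exact: (frank_wolfe_step F_convex F_diff C_diam F_smooth g0 Cx Cx' Cs
    (SFW_v sfw t w)).
Qed.

Lemma frank_wolfe_as_cvg : {ae Q, forall w,
  (fun t => F (x t w) - F xstar) @ \oo --> (0 : R)}.
Proof. by apply: filterS err_cvg0 => w; exact: gap_cvg0. Qed.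

End stochastic_frank_wolfe.

Theorem theorem4 (R : realType) (n : nat)
    (* C is a nonempty compact convex subset of R^n *)
    (C : set 'rV[R]_n)
    (C_neq0 : C !=set0) (C_compact : compact C)
    (C_convex : convex_set (C : set (convex_lmodType 'rV[R]_n)))
    (* the law P of z, and the stochastic function Ftilde, defined on an open
       set U containing C and differentiable in x at the points of C *)
    (dZ : measure_display) (Z : measurableType dZ) (P : probability Z R)
    (Ftilde : 'rV[R]_n -> Z -> R) (U : set 'rV[R]_n)
    (U_open : open U) (subCU : C `<=` U)
    (Ftilde_meas : measurable_fun ((U : set (borel_rV R n)) `*` [set: Z])
       (fun p : borel_rV R n * Z => Ftilde p.1 p.2))
    (Ftilde_int : forall x, U x -> P.-integrable [set: Z] (EFin \o Ftilde x))
    (Ftilde_diff : forall x z, C x -> differentiable (Ftilde ^~ z) x)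
    (* (1) *)
    (D : R)
    (C_diam : forall x y, C x -> C y -> norm2 (x - y) <= D)
    (* (2) *)
    (L : R)
    (F_convex : convex_function (C : set (convex_lmodType 'rV[R]_n))
       (expected_fun P Ftilde))
    (F_diff : forall x, C x -> differentiable (expected_fun P Ftilde) x)
    (F_smooth : forall x y, C x -> C y ->
       norm2 (grad (expected_fun P Ftilde) x - grad (expected_fun P Ftilde) y)
         <= L * norm2 (x - y))
    (* (3) *)
    (sigma : R)
    (unbiased : forall x, C x -> forall i : 'I_n,
       ('E_P[(fun z => grad (Ftilde ^~ z) x 0 i)%R]
         = (grad (expected_fun P Ftilde) x 0 i)%:E)%E)
    (variance : forall x, C x ->
       ('E_P[(fun z => norm2 (grad (Ftilde ^~ z) x
                              - grad (expected_fun P Ftilde) x) ^+ 2)%R]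
         <= (sigma ^+ 2)%:E)%E)
    (* stepsizes *)
    (rho gamma : nat -> R)
    (rho_gt0 : forall t, 0 < rho t)
    (gamma_gt0_le1 : forall t, 0 < gamma t <= 1)
    (sum_rho : (\sum_(0 <= t <oo) (rho t)%:E = +oo)%E)
    (sum_rho2 : (\sum_(0 <= t <oo) (rho t ^+ 2)%:E < +oo)%E)
    (sum_gamma : (\sum_(0 <= t <oo) (gamma t)%:E = +oo)%E)
    (sum_gamma2_rho : (\sum_(0 <= t <oo) (gamma t ^+ 2 / rho t)%:E < +oo)%E)
    (* i.i.d. samples z_1, z_2, ... with law P, and the iterates *)
    (dW : measure_display) (W : measurableType dW) (Q : probability W R)
    (z : nat -> {RV Q >-> Z})
    (z_iid : iid_samples P (fun k => z k.+1))
    (x0 : 'rV[R]_n) (x0_in : C x0)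
    (x d v : nat -> W -> 'rV[R]_n)
    (sfw : is_SFW C Ftilde rho gamma x0 z x d v)
    (xstar : 'rV[R]_n)
    (xstar_min : argmin C (expected_fun P Ftilde) xstar) :
  {ae Q, forall w,
     (fun t => expected_fun P Ftilde (x t w) - expected_fun P Ftilde xstar)
       @ \oo --> (0 : R)}.
Proof.
exact: (frank_wolfe_as_cvg C_compact C_convex U_open subCU Ftilde_meas
  Ftilde_diff C_diam F_smooth unbiased variance rho_gt0 gamma_gt0_le1 z_iid
  x0_in sfw sum_rho sum_rho2 sum_gamma2_rho F_convex F_diff sum_gamma
  xstar_min).
Qed.
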